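(* Let $P_1,\ldots,P_k$ be rational polytopes in $\mathbb{R}^n$ with $\dim(P_1+\cdots+P_k)=n$. Then for every $I\in\{0,\ldots,n\}^k$ with $|I|_1\le n$, the coefficient function $\mathrm{Q}_I(P_1,\ldots,P_k,\cdot)$ is a piecewise-defined polynomial function of total degree at most $n-|I|_1$ and of degree at most $n-I_j$ in $r_j$ for each $j\in\{1,\ldots,k\}$. Moreover, $$\frac{\partial}{\partial r_j}\mathrm{Q}_I(P_1,\ldots,P_k,r)=-(I_j+1)\,\mathrm{Q}_{I+e(j)}(P_1,\ldots,P_k,r)$$ for all $j\in\{1,\ldots,k\}$, all $I$ with $|I|_1<n$, and all $r\in\mathbb{Q}_{\ge0}^k$ such that $\mathrm{Q}(P_1,\ldots,P_k,\cdot)$ is continuous at $r+U\odot(\widehat{\mathrm{den}}(P_1),\ldots,\widehat{\mathrm{den}}(P_k))$ for all $U\in\mathbb{Z}_{\ge0}^k$.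
   Context: A rational polytope is the convex hull of finitely many points of $\mathbb{Q}^n$. For rational polytopes $P_1,\ldots,P_k\subset\mathbb{R}^n$, define $\mathrm{Q}(P_1,\ldots,P_k,\cdot):\mathbb{Q}_{\ge0}^k\to\mathbb{Z}_{\ge0}$ by $$\mathrm{Q}(P_1,\ldots,P_k,r)=\#\Bigl(\bigl(\textstyle\sum_{i=1}^k r_iP_i\bigr)\cap\mathbb{Z}^n\Bigr),\qquad r=(r_1,\ldots,r_k),$$ where the sum is the Minkowski sum. The rational denominator $\widehat{\mathrm{den}}(P)$ of a rational polytope $P$ is the smallest positive rational number $d$ such that $dP$ is an integral polytope (all vertices in $\mathbb{Z}^n$); for $P=\{0\}$, where no smallest such number exists, put $\widehat{\mathrm{den}}(P)=1$. A function $p:\mathbb{Q}_{\ge0}^k\to\mathbb{Q}$ is a rational quasi-polynomial of total degree $N$ with period $d=(d_1,\ldots,d_k)$ if there are functions $p_I:\mathbb{Q}_{\ge0}^k\to\mathbb{Q}$, $I\in\{0,\ldots,N\}^k$, $|I|_1\le N$, periodic with period $d_i$ in the $i$th component for each $i$, with $p(r)=\sum_{|I|_1\le N}p_I(r)r^I$; $p_I$ is called the $I$th coefficient. By a theorem of McMullen, $\mathrm{Q}(P_1,\ldots,P_k,\cdot)$ is a rational quasi-polynomial of total degree $\dim(P_1+\cdots+P_k)$ with period $(\widehat{\mathrm{den}}(P_1),\ldots,\widehat{\mathrm{den}}(P_k))$; its $I$th coefficient is denoted $\mathrm{Q}_I(P_1,\ldots,P_k,\cdot)$. Notation: $r^I=\prod_j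 r_j^{I_j}$ with $0^0=1$; $|I|_1=\sum_j I_j$; $e(j)$ is the $j$th unit vector; $r\odot s=(r_1s_1,\ldots,r_ks_k)$. A function on $\mathbb{Q}_{\ge0}^k$ is a piecewise-defined polynomial if $\mathbb{R}_{\ge0}^k$ can be partitioned into a locally finite family of relatively open polyhedra such that on the rational points of each of them the function coincides with a polynomial (here satisfying the stated degree bounds). Continuity and partial derivatives are those of functions on $\mathbb{Q}_{\ge0}^k$, i.e. limits are taken over rational points of the orthant (so the derivative in $r_j$ is one-sided if $r_j=0$). *)

(* Defs.v *)
From mathcomp Require Import all_boot all_order all_algebra.
From mathcomp Require mpoly.

Set Implicit Arguments.
Unset Strict Implicit.
Unset Printing Implicit Defensive.

Local Open Scope ring_scope.

(* The notations of [mpoly] clash with those of mathcomp-analysis, hence the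
   import limited to this module. *)
Module MPolyDegrees.
Import mpoly.

(* [f] coincides on [S] with a polynomial of total degree at most [D] and of
   degree at most [E j] in the [j]th variable; [msize p] is the total degree
   plus one for [p != 0], and [0] for [p = 0]. *)
Definition polynomial_on (k D : nat) (E : 'I_k -> nat)
    (S : 'rV[rat]_k -> Prop) (f : 'rV[rat]_k -> rat) : Prop :=
  exists p : {mpoly rat[k]},
    [/\ (msize p <= D.+1)%N,
        forall m (j : 'I_k), m \in msupp p -> (m j <= E j)%N
      & forall r, S r -> f r = p.@[fun j => r 0 j]].

End MPolyDegrees.
Export MPolyDegrees.

From mathcomp Require Import finmap all_classical all_reals all_analysis.

Import Order.TTheory GRing.Theory Num.Theory.
Import numFieldNormedType.Exports.

Local Open Scope classical_set_scope.

Section ConvexGeometry.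
Context {R : realType} {n : nat}.
Implicit Types A P : set 'rV[R]_n.

Definition conv_hull A : set 'rV[R]_n :=
  [set x | exists m (v : 'I_m -> 'rV[R]_n) (w : 'I_m -> R),
    [/\ forall i, A (v i), forall i, 0 <= w i, \sum_i w i = 1
      & x = \sum_i w i *: v i]].

Definition aff_hull A : set 'rV[R]_n :=
  [set x | exists m (v : 'I_m -> 'rV[R]_n) (w : 'I_m -> R),
    [/\ forall i, A (v i), \sum_i w i = 1 & x = \sum_i w i *: v i]].

(* The affine hull of [A] is a translate of a [d]-dimensional subspace; no [d]
   qualifies for the empty set. *)
Definition has_dim A (d : nat) : Prop :=
  exists (x0 : 'rV[R]_n) (W : {vspace 'rV[R]_n}),
    aff_hull A = [set x0 + w | w in [set` W]] /\ \dim W = d.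

Definition relint A : set 'rV[R]_n :=
  [set x | A x /\ within (aff_hull A) (nbhs x) A].

Definition polyhedron A : Prop :=
  exists m (M : 'M[R]_(n, m)) (b : 'rV[R]_m),
    A = [set x | forall i, (x *m M) 0 i <= b 0 i].

Definition relopen_polyhedron A : Prop :=
  exists K : set 'rV[R]_n, polyhedron K /\ A = relint K.

Definition rational_polytope P : Prop :=
  exists V : seq 'rV[rat]_n,
    V != [::] /\ P = conv_hull [set map_mx ratr v | v in [set` V]].

(* The vertices of a polytope are its extreme points. *)
Definition vertices P : set 'rV[R]_n :=
  [set x | P x /\ forall y z (t : R), P y -> P z -> 0 < t < 1 ->
    x = t *: y + (1 - t) *: z -> y = x /\ z = x].

Definition int_points : set 'rV[R]_n := [set x | x \is a mxOver Num.int].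

Definition integral_polytope P : Prop := vertices P `<=` int_points.

Definition dilate (d : rat) P : set 'rV[R]_n := [set ratr d *: x | x in P].

Definition rden P : rat :=
  if `[< P = [set 0] >] then 1 else
  xget 1 [set d : rat | [/\ 0 < d, integral_polytope (dilate d P)
    & forall d' : rat, 0 < d' -> integral_polytope (dilate d' P) -> d <= d']].

Definition minkowski_sum k (P : 'I_k -> set 'rV[R]_n) : set 'rV[R]_n :=
  [set x | exists p : 'I_k -> 'rV[R]_n, (forall i, P i (p i)) /\ x = \sum_i p i].

Definition lattice_count k (P : 'I_k -> set 'rV[R]_n) (r : 'rV[rat]_k) : nat :=
  #|` fset_set (minkowski_sum (fun i => dilate (r 0 i) (P i)) `&` int_points) |.

End ConvexGeometry.

Definition orthant (F : numDomainType) (k : nat) : set 'rV[F]_k :=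
  [set r | forall j, 0 <= r 0 j].
Arguments orthant : clear implicits.

Definition mnorm k (I : 'I_k -> nat) : nat := (\sum_j I j)%N.

(* [I + e(j)] *)
Definition mincr k (I : 'I_k -> nat) (j : 'I_k) : 'I_k -> nat :=
  fun l => (I l + (l == j))%N.

(* Functions on the nonnegative rational orthant are functions on all of
   ['rV[rat]_k] whose values outside of [orthant rat k] are never used. *)

(* The functions [c I] with [mnorm I <= N] are coefficients that make [p] a
   rational quasi-polynomial of total degree [N] with period [d]. Each entry of
   an [I] with [mnorm I <= N] is at most [N], so that the sum ranges over all
   these [I]. *)
Definition quasi_polynomial_coefs k (N : nat) (d : 'I_k -> rat)
    (p : 'rV[rat]_k -> rat) (c : ('I_k -> nat) -> 'rV[rat]_k -> rat) : Prop :=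
  (forall I : 'I_k -> nat, (mnorm I <= N)%N ->
     forall (i : 'I_k) r, orthant rat k r ->
     c I (r + d i *: delta_mx 0 i) = c I r) /\
  (forall r, orthant rat k r ->
     p r = \sum_(I : {ffun 'I_k -> 'I_N.+1} | (mnorm (fun j => I j) <= N)%N)
             c (fun j => I j) r * \prod_j r 0 j ^+ I j).

Definition locally_finite (T : topologicalType) (F : set (set T)) : Prop :=
  forall x : T, exists2 U, nbhs x U & finite_set [set S | F S /\ S `&` U !=set0].

(* [R] is the field of real numbers over which the pieces are polyhedra. *)
Definition piecewise_polynomial (R : realType) k (D : nat) (E : 'I_k -> nat)
    (f : 'rV[rat]_k -> rat) : Prop :=
  exists F : set (set 'rV[R]_k),
    [/\ partition F id (orthant R k),
        locally_finite F,
        F `<=` relopen_polyhedron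
      & forall S, F S -> polynomial_on D E (fun r => S (map_mx ratr r)) f].

(* The topology on [rat] is carried by its alias [rat^o]. *)
Definition continuous_on_orthant_at k (f : 'rV[rat]_k -> rat)
    (x : 'rV[rat]_k) : Prop :=
  (f : 'rV[rat^o]_k -> rat^o)
    @ within (orthant rat k) (nbhs (x : 'rV[rat^o]_k)) --> (f x : rat^o).

Definition has_partial k (f : 'rV[rat]_k -> rat) (j : 'I_k)
    (r : 'rV[rat]_k) (l : rat) : Prop :=
  ((fun h => (f (r + h *: delta_mx 0 j) - f r) / h) : rat^o -> rat^o)
    @ within [set h | orthant rat k (r + h *: delta_mx 0 j)] ((0 : rat^o)^')
    --> (l : rat^o).

(* Main.v *)
Require Import Defs.
From mathcomp Require Import all_boot all_order all_algebra.
From mathcomp Require mpoly.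

(* The cone generated by the points (e_i, v), v a vertex of P_i, is cut out by
   finitely many rational inequalities c1 . r + c2 . x <= 0 (Fourier-Motzkin),
   and x lies in sum_i r_i P_i iff (r, x) lies in this cone. With c2 integral,
   the lattice points of sum_i r_i P_i thus only depend on the ceilings of the
   numbers c1 . r, and, if c1 is scaled suitably, the same ceilings determine
   the number of lattice points of sum_i (r_i + U_i d_i) P_i for all integral
   U >= 0. So the orthant decomposes into relatively open cells on which
   r |-> Q(r + U (.) d) is constant for every U.
   By periodicity, Q(r + U (.) d) = sum_I Q_I(r) (r + U (.) d)^I is the value at
   U (.) d of the polynomial F_r(y) = sum_I Q_I(r) (r + y)^I of degree <= n, so
   that F_r = F is constant on each cell, and Q_I(r) is the coefficient of y^I
   in F(y - r). This is a polynomial in r with the stated degrees; its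
   derivative in r_j comes from d/dr_j F(y - r) = - (d_j F)(y - r). At points of
   continuity of the integer-valued Q(. + U (.) d), U in {0..n}^k, this function
   is locally constant and the same argument applies. *)

Set Implicit Arguments.
Unset Strict Implicit.
Unset Printing Implicit Defensive.

Import Order.TTheory GRing.Theory Num.Theory.

Local Open Scope ring_scope.

(** * Coefficients of polynomials from their values on a grid *)

Section GridPolynomials.
Variables (F : fieldType) (k N : nat).
Implicit Types (a b : {ffun 'I_k -> 'I_N.+1} -> F) (x y t : 'I_k -> F).
Implicit Types I J U : {ffun 'I_k -> 'I_N.+1}.

Definition poly_eval a y : F := \sum_I a I * \prod_(j < k) y j ^+ I j.

(* A tensor product of inverse Vandermonde matrices recovers the coefficients
   from the values on the grid. *)
Lemma grid_eval_eq0 (x : 'I_k -> 'I_N.+1 -> F) a :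
    (forall j, injective (x j)) ->
    (forall U, poly_eval a (fun j => x j (U j)) = 0) -> forall I, a I = 0.
Proof.
move=> x_inj a0 I0.
pose V j := Vandermonde N.+1 (\row_u x j u).
have V_unit j : V j \in unitmx.
  rewrite unitmxE unitfE det_Vandermonde.
  apply/prodf_neq0 => u _; apply/prodf_neq0 => v ltuv.
  by rewrite !mxE subr_eq0 (inj_eq (x_inj j)) eq_sym neq_ltn ltuv.
have VW I : \prod_(j < k) (V j *m invmx (V j)) (I j) (I0 j) = (I == I0)%:R.
  under eq_bigr do rewrite mulmxV// mxE.
  case: (I =P I0) => [->|neqI]; first by rewrite big1// => j _; rewrite eqxx.
  have /forallPn[j neqIj] : ~~ [forall j, I j == I0 j].
    by apply/forallP => eqI; apply: neqI; apply/ffunP => j; apply/eqP.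
  by rewrite (bigD1 j)//= (negPf neqIj) mul0r.
transitivity (\sum_I a I * \prod_(j < k) (V j *m invmx (V j)) (I j) (I0 j)).
  under eq_bigr do rewrite VW.
  rewrite (bigD1 I0)//= eqxx mulr1 big1 ?addr0// => I /negPf->.
  by rewrite mulr0.
transitivity (\sum_(U : {ffun 'I_k -> 'I_N.+1})
                poly_eval a (fun j => x j (U j)) *
                \prod_(j < k) invmx (V j) (U j) (I0 j)); last first.
  by rewrite big1// => U _; rewrite a0 mul0r.
under eq_bigr => I _ do [under eq_bigr do rewrite mxE;
  rewrite bigA_distr_bigA mulr_sumr].
rewrite exchange_big; apply: eq_bigr => U _ /=.
rewrite mulr_suml; apply: eq_bigr => I _.
rewrite -mulrA -big_split; congr (_ * _); apply: eq_bigr => j _.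
by rewrite !mxE.
Qed.

Lemma grid_eval_inj (x : 'I_k -> 'I_N.+1 -> F) a b :
    (forall j, injective (x j)) ->
    (forall U, poly_eval a (fun j => x j (U j)) =
               poly_eval b (fun j => x j (U j))) -> a =1 b.
Proof.
move=> x_inj eqab I; apply/eqP; rewrite -subr_eq0; apply/eqP.
apply: (grid_eval_eq0 x_inj (a := fun I => a I - b I)) => U.
rewrite /poly_eval; under eq_bigr do rewrite mulrBl.
by rewrite sumrB; apply/eqP; rewrite subr_eq0; apply/eqP/eqab.
Qed.

(** Coefficients of [y |-> a(y + t)], by binomial expansion. Where [I j < J j] the binomial
    vanishes, so the truncated subtraction is harmless. *)
Definition poly_shift t a J : F :=
  \sum_I a I * \prod_(j < k) ('C(I j, J j)%:R * t j ^+ (I j - J j)).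

Lemma poly_evalD t a y :
  poly_eval (poly_shift t a) y = poly_eval a (fun j => y j + t j).
Proof.
rewrite /poly_eval /poly_shift; under eq_bigr do rewrite mulr_suml.
rewrite exchange_big; apply: eq_bigr => I _ /=.
under eq_bigr do rewrite -mulrA -big_split /=.
rewrite -big_distrr /=.
rewrite -(bigA_distr_bigA (fun j (u : 'I_N.+1) =>
  'C(I j, u)%:R * t j ^+ (I j - u) * y j ^+ u)).
congr (_ * _); apply: eq_bigr => j _.
rewrite addrC exprDn (big_ord_widen N.+1
  (fun u => t j ^+ (I j - u) * y j ^+ u *+ 'C(I j, u)) (ltn_ord (I j))).
rewrite [RHS]big_mkcond; apply: eq_bigr => u _ /=.
case: ltnP => [_|ltIu]; first by rewrite -mulrA mulr_natl.
by rewrite bin_small ?mul0r.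
Qed.

End GridPolynomials.

(** On values the two shifts cancel, and the values determine the coefficients because the nodes
    [0..N] are distinct in characteristic zero. *)
Lemma poly_shiftK (F : numFieldType) (k N : nat) (t : 'I_k -> F)
    (a : {ffun 'I_k -> 'I_N.+1} -> F) :
  poly_shift (fun j => - t j) (poly_shift t a) =1 a.
Proof.
apply: (@grid_eval_inj _ _ _ (fun _ u => (u : nat)%:R)).
  by move=> _ u v /eqP; rewrite eqr_nat => /eqP/val_inj.
move=> U; rewrite !poly_evalD; apply: eq_bigr => I _.
by congr (_ * _); apply: eq_bigr => j _; rewrite subrK.
Qed.

Module ShiftMPoly.
Import mpoly.

(** The coefficient of [y^I] in [f(y - r)] only involves monomials [r^(J - I)] with [J >= I] and
    [|J| <= N], whence both degree bounds. *)
Lemma polynomial_on_shift k N (f : {ffun 'I_k -> 'I_N.+1} -> rat)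
    (I : {ffun 'I_k -> 'I_N.+1}) (S : 'rV[rat]_k -> Prop)
    (g : 'rV[rat]_k -> rat) :
    (forall J : {ffun 'I_k -> 'I_N.+1},
       (N < mnorm (fun j => J j))%N -> f J = 0) ->
    (forall r, S r -> g r = poly_shift (fun j => - r 0 j) f I) ->
  polynomial_on (N - mnorm (fun j => I j)) (fun j => (N - I j)%N) S g.
Proof.
move=> f0 gE.
pose m (J : {ffun 'I_k -> 'I_N.+1}) : 'X_{1..k} :=
  [multinom (J j - I j)%N | j < k].
pose a (J : {ffun 'I_k -> 'I_N.+1}) :=
  f J * \prod_(j < k) ('C(J j, I j)%:R * (-1) ^+ (J j - I j)).
pose p : {mpoly rat[k]} := \sum_J a J *: 'X_[m J].
have supp_p l : l \in msupp p ->
    exists J : {ffun 'I_k -> 'I_N.+1}, [/\ (mnorm (fun j => J j) <= N)%N,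
      forall j, (I j <= J j)%N & l = m J].
  rewrite mcoeff_msupp => pl.
  have [J /andP[aJ /eqP mJ]] : exists J : {ffun 'I_k -> 'I_N.+1},
      (a J != 0) && (m J == l).
    apply/existsP; apply: contraNT pl => /existsPn H.
    rewrite /p raddf_sum /= big1// => J _; rewrite mcoeffZ mcoeffX.
    move: (H J); rewrite negb_and negbK => /orP[/eqP->|/negPf->];
    by rewrite ?mul0r ?mulr0.
  exists J; split => //.
    rewrite leqNgt; apply: contraNN aJ => /f0.
    by rewrite /a => ->; rewrite mul0r.
  move=> j; rewrite leqNgt; apply: contraNN aJ => ltJI.
  by rewrite /a (bigD1 j)//= bin_small// !mul0r mulr0.
exists p; split.
- rewrite msizeE; apply/bigmax_leqP_seq => l /supp_p[J [leJN leIJ ->]] _.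
  rewrite ltnS mdegE; under eq_bigr do rewrite mnmE.
  by rewrite sumnB; [exact: leq_sub2r|].
- move=> l j /supp_p[J [leJN leIJ ->]]; rewrite mnmE leq_sub2r//.
  by rewrite -ltnS ltn_ord.
- move=> r /gE->; rewrite /p raddf_sum; apply: eq_bigr => J _ /=.
  rewrite mevalZ mevalX -mulrA -big_split; congr (_ * _).
  by apply: eq_bigr => j _ /=; rewrite mnmE -mulrA -exprMn mulN1r.
Qed.

End ShiftMPoly.

From mathcomp Require Import all_classical all_reals all_analysis.
From mathcomp Require Import ring lra zify.

Import numFieldNormedType.Exports.

Local Open Scope classical_set_scope.

(** * Quasi-polynomials recentred at a point *)

Section QuasiPolynomial.
Variables (k N : nat) (d : 'I_k -> rat).
Variables (p : 'rV[rat]_k -> rat) (c : ('I_k -> nat) -> 'rV[rat]_k -> rat).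
Hypothesis c_coefs : quasi_polynomial_coefs N d p c.
Hypothesis d_gt0 : forall i, 0 < d i.
Implicit Types I J : {ffun 'I_k -> 'I_N.+1}.

Definition lattice_shift (U : 'I_k -> nat) : 'rV[rat]_k :=
  \row_i ((U i)%:R * d i).

Lemma orthantD (r s : 'rV[rat]_k) :
  orthant rat k r -> orthant rat k s -> orthant rat k (r + s).
Proof. by move=> r0 s0 j; rewrite mxE addr_ge0// ?r0 ?s0. Qed.

Lemma orthant_lattice_shift U : orthant rat k (lattice_shift U).
Proof. by move=> j; rewrite mxE mulr_ge0 ?ler0n// ltW. Qed.

(** The periods are added one coordinate at a time; periodicity is only given on the orthant, which
    no partial sum leaves. *)
Lemma coef_periodic (I : 'I_k -> nat) r U : (mnorm I <= N)%N ->
  orthant rat k r -> c I (r + lattice_shift U) = c I r.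
Proof.
move=> leIN.
have delta_ge0 i a : 0 <= a -> orthant rat k (a *: delta_mx 0 i).
  by move=> a0 j; rewrite !mxE mulr_ge0// ler0n.
have period i m s : orthant rat k s ->
    c I (s + (m%:R * d i) *: delta_mx 0 i) = c I s.
  move=> s0; elim: m => [|m IHm]; first by rewrite mul0r scale0r addr0.
  rewrite -{1}(addn1 m) natrD mulrDl mul1r scalerDl addrA.
  rewrite (proj1 c_coefs)//; apply: orthantD => //.
  by apply: delta_ge0; rewrite mulr_ge0 ?ler0n// ltW.
rewrite (row_sum_delta (lattice_shift U)).
elim: (index_enum _) r => [|i s IHs] r r0; first by rewrite big_nil addr0.
rewrite big_cons addrA mxE IHs ?period//.
by apply: orthantD => //; apply: delta_ge0; rewrite mulr_ge0 ?ler0n// ltW.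
Qed.

(** Extension by zero to the whole box, as [poly_eval] demands. *)
Definition coefs_at r I : rat :=
  if (mnorm (fun j => I j) <= N)%N then c (fun j => I j) r else 0.

(* The coefficients of [y |-> \sum_I c I r * (r + y)^I], which by periodicity
   takes the value [p (r + U (.) d)] at [y = U (.) d]. *)
Definition centered_coefs (r : 'rV[rat]_k) : {ffun 'I_k -> 'I_N.+1} -> rat :=
  poly_shift (fun j => r 0 j) (coefs_at r).

Lemma centered_coefs_eval r U : orthant rat k r ->
  poly_eval (centered_coefs r) (fun j => (U j)%:R * d j) =
  p (r + lattice_shift U).
Proof.
move=> r0; rewrite poly_evalD (proj2 c_coefs); last first.
  exact/orthantD/orthant_lattice_shift.
rewrite [RHS]big_mkcond; apply: eq_bigr => I _; rewrite /coefs_at.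
case: ifP => [leIN|_]; last by rewrite mul0r.
rewrite coef_periodic//; congr (_ * _).
by apply: eq_bigr => j _; rewrite !mxE addrC.
Qed.

(** If [|I| <= N < |J|], then [I j < J j] for some [j], which kills the binomial: a shift does not
    raise the total degree. *)
Lemma centered_coefs_degree r J :
  (N < mnorm (fun j => J j))%N -> centered_coefs r J = 0.
Proof.
move=> ltNJ; apply: big1 => I _; rewrite /coefs_at; case: ifP => [leIN|_].
  have /existsP[j ltIJ] : [exists j, (I j < J j)%N].
    rewrite -[X in is_true X]negbK negb_exists; apply/negP => /forallP leJI.
    suff: (N < N)%N by rewrite ltnn.
    apply: leq_trans ltNJ (leq_trans _ leIN); apply: leq_sum => j _.
    by rewrite leqNgt.
  by rewrite (bigD1 j)//= bin_small// !mul0r mulr0.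
by rewrite mul0r.
Qed.

(** Equal values of [p] make the polynomials centered at [r] and [s] agree on the grid [U (.) d],
    hence coincide; shifting back by [s] recovers the coefficients at [s]. *)
Lemma coef_eq r s I : orthant rat k r -> orthant rat k s ->
    (forall U : {ffun 'I_k -> 'I_N.+1},
       p (r + lattice_shift (fun j => U j)) =
       p (s + lattice_shift (fun j => U j))) ->
    (mnorm (fun j => I j) <= N)%N ->
  c (fun j => I j) s = poly_shift (fun j => - s 0 j) (centered_coefs r) I.
Proof.
move=> r0 s0 eqrs leIN.
have eqF : centered_coefs r =1 centered_coefs s.
  apply: (@grid_eval_inj _ _ _ (fun j u => (u : nat)%:R * d j)).
    move=> j u v /mulIf; rewrite gt_eqF// => /(_ isT)/eqP.
    by rewrite eqr_nat => /eqP/val_inj.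
  move=> U.
  by rewrite (centered_coefs_eval (fun j => U j))// eqrs -centered_coefs_eval.
transitivity (coefs_at s I); first by rewrite /coefs_at leIN.
rewrite -(poly_shiftK (fun j => s 0 j) (coefs_at s)).
by apply: eq_bigr => J _; rewrite -/(centered_coefs s) eqF.
Qed.

End QuasiPolynomial.

(** * Lattice points of Minkowski sums *)

Section RationalCones.
Variables (R : realFieldType) (m : nat).
Implicit Types (G : seq 'rV[rat]_m) (x : 'rV[R]_m) (c : 'cV[rat]_m).

Fixpoint in_cone G x : Prop :=
  if G is g :: G' then exists2 y, 0 <= y & in_cone G' (x - y *: map_mx ratr g)
  else x = 0.

Definition rat_form c x : R := (x *m map_mx ratr c) 0 0.

Lemma rat_formD c x y : rat_form c (x + y) = rat_form c x + rat_form c y.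
Proof. by rewrite /rat_form mulmxDl mxE. Qed.

Lemma rat_formZ c a x : rat_form c (a *: x) = a * rat_form c x.
Proof. by rewrite /rat_form -scalemxAl mxE. Qed.

Lemma rat_form_sum c (T : Type) (s : seq T) (Q : pred T) (f : T -> 'rV[R]_m) :
  rat_form c (\sum_(i <- s | Q i) f i) = \sum_(i <- s | Q i) rat_form c (f i).
Proof. by rewrite /rat_form mulmx_suml summxE. Qed.

Lemma rat_form_ratr c (g : 'rV[rat]_m) :
  rat_form c (map_mx ratr g) = ratr ((g *m c) 0 0).
Proof. by rewrite /rat_form -map_mxM mxE. Qed.

Lemma in_cone_ind G (D : 'rV[R]_m -> Prop) : D 0 ->
    (forall g x y, g \in G -> 0 <= y -> D x -> D (x + y *: map_mx ratr g)) ->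
  forall x, in_cone G x -> D x.
Proof.
move=> D0; elim: G => [|g G IHG] DG x /=; first by move->.
move=> [y y0 /IHG Dx]; rewrite -[x](subrK (y *: map_mx ratr g)).
apply: (DG); rewrite ?mem_head//; apply: Dx => h z u hG.
by apply: DG; rewrite inE hG orbT.
Qed.

Lemma in_cone0 G : in_cone G 0.
Proof.
by elim: G => [|g G IHG] //=; exists 0; rewrite ?lexx// scale0r subr0.
Qed.

Lemma in_coneD G x g y : g \in G -> 0 <= y -> in_cone G x ->
  in_cone G (x + y *: map_mx ratr g).
Proof.
move=> + y0; elim: G x => [//|h G IHG] x /=; rewrite inE => /predU1P[->|gG].
  move=> [z z0 Gx]; exists (z + y); rewrite ?addr_ge0//.
  by rewrite scalerDl opprD addrACA subrr addr0.
by move=> [z z0 Gx]; exists z => //; rewrite addrAC; apply: IHG.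
Qed.

(* Fourier-Motzkin: adding a generator [g] to a cone amounts to eliminating the
   coefficient of [g] from the inequalities of the cone. *)
Lemma cone_halfspaces G :
  exists s : seq 'cV[rat]_m,
    forall x, in_cone G x <-> forall c, c \in s -> rat_form c x <= 0.
Proof.
elim: G => [|g G [s sG]].
  exists ([seq delta_mx i 0 | i <- enum 'I_m] ++
          [seq - delta_mx i 0 | i <- enum 'I_m]) => x /=; split.
    by move=> -> c _; rewrite /rat_form mul0mx mxE.
  move=> xs; apply/rowP => i; rewrite mxE.
  have xi : rat_form (delta_mx i 0) x = x 0 i.
    rewrite /rat_form mxE (bigD1 i)//= big1 ?addr0.
      by rewrite !mxE !eqxx rmorph1 mulr1.
    by move=> j /negPf neqji; rewrite !mxE neqji rmorph0 mulr0.
  apply/le_anti/andP; split.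
    rewrite -xi; apply: xs.
    by rewrite mem_cat (map_f (fun i => delta_mx i 0)) ?mem_enum.
  rewrite -oppr_le0 -xi.
  have -> : - rat_form (delta_mx i 0) x = rat_form (- delta_mx i 0) x.
    by rewrite /rat_form map_mxN mulmxN [in RHS]mxE.
  apply: xs; rewrite mem_cat; apply/orP; right.
  by apply: (map_f (fun i => - delta_mx i 0)); rewrite mem_enum.
pose gm c : rat := (g *m c) 0 0.
have formB c x y : rat_form c (x - y *: map_mx ratr g) =
    rat_form c x - y * ratr (gm c).
  by rewrite rat_formD -scaleNr rat_formZ mulNr rat_form_ratr.
(* For [gm c1 > 0 > gm c2] this is a positive combination of [c1] and [c2] that vanishes at [g]. *)
pose comb c1 c2 := gm c1 *: c2 - gm c2 *: c1.
have combE c1 c2 x : rat_form (comb c1 c2) x =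
    ratr (gm c1) * rat_form c2 x - ratr (gm c2) * rat_form c1 x.
  rewrite /rat_form /comb map_mxB !map_mxZ mulmxDr mulmxN -!scalemxAr.
  by rewrite !mxE.
exists ([seq c <- s | gm c <= 0] ++
  [seq comb c1 c2 | c1 <- [seq c <- s | 0 < gm c],
                    c2 <- [seq c <- s | gm c < 0]]) => x /=; split.
  move=> [y y0 /sG xs] c; rewrite mem_cat => /orP[|/allpairsP[[c1 c2] /= []]].
    rewrite mem_filter => /andP[c0 cs]; have := xs c cs.
    rewrite formB subr_le0 => /le_trans; apply.
    by rewrite mulr_ge0_le0// lerq0.
  rewrite !mem_filter => /andP[c10 c1s] /andP[c20 c2s] ->; rewrite combE.
  have := xs c1 c1s; have := xs c2 c2s; rewrite !formB.
  have : 0 < ratr (gm c1) :> R by rewrite ltr0q.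
  have : ratr (gm c2) < 0 :> R by rewrite ltrq0.
  by nra.
(* Forms positive at [g] bound [y] from below; [y] is the largest of these bounds and [0]. The
   combined inequalities keep it under the upper bounds from forms negative at [g]. *)
move=> xs; pose y := \big[Num.max/0]_(c <- s | 0 < gm c)
                       (rat_form c x / ratr (gm c)).
exists y.
  by rewrite /y; elim/big_rec: _ => // c z _ z0; rewrite le_max z0 orbT.
apply/sG => c cs; rewrite formB subr_le0.
have [c0|c0] := ltP 0 (gm c).
  rewrite -ler_pdivrMr ?ltr0q// /y.
  exact: (@le_bigmax_seq _ R _ s 0 c (fun c => 0 < gm c)
    (fun c => rat_form c x / ratr (gm c)) cs c0).
have xc : rat_form c x <= 0 by apply: xs; rewrite mem_cat mem_filter c0 cs.
move: c0; rewrite le_eqVlt => /predU1P[->|c0]; first by rewrite rmorph0 mulr0.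
rewrite -ler_ndivlMr ?ltrq0// /y big_seq_cond.
apply: bigmax_le => [|c1 /andP[c1s c10]].
  by rewrite mulr_le0// invr_le0 lerq0 ltW.
have : rat_form (comb c1 c) x <= 0.
  apply: xs; rewrite mem_cat; apply/orP; right; apply/allpairsP.
  by exists (c1, c); rewrite !mem_filter c10 c0 cs c1s.
rewrite combE subr_le0 => le1.
rewrite ler_pdivrMr ?ltr0q// mulrAC ler_ndivlMr ?ltrq0//.
by rewrite mulrC [_ * ratr _]mulrC.
Qed.

End RationalCones.

Lemma sub_conv_hull (R : realType) n (A : set 'rV[R]_n) : A `<=` conv_hull A.
Proof.
move=> x Ax; exists 1%N, (fun=> x), (fun=> 1); split=> //.
- by rewrite big_ord1.
- by rewrite big_ord1 scale1r.
Qed.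

Lemma conv_hull_segment (R : realType) n (A : set 'rV[R]_n) x y (t : R) :
  conv_hull A x -> A y -> 0 <= t <= 1 -> conv_hull A ((1 - t) *: x + t *: y).
Proof.
move=> [m [v [w [Av w0 w1 ->]]]] Ay /andP[t0 t1].
exists m.+1, (fun i => if unlift ord0 i is Some j then v j else y),
  (fun i => if unlift ord0 i is Some j then (1 - t) * w j else t); split.
- by move=> i; case: unliftP => [j _|_].
- by move=> i; case: unliftP => [j _|_] //; rewrite mulr_ge0 ?subr_ge0.
- rewrite big_ord_recl unlift_none; under eq_bigr do rewrite liftK.
  by rewrite -mulr_sumr w1 mulr1 subrKC.
- rewrite big_ord_recl !unlift_none addrC; congr (_ + _).
  under [in RHS]eq_bigr do rewrite !liftK.
  by rewrite scaler_sumr; apply: eq_bigr => i _; rewrite scalerA.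
Qed.

Section MinkowskiCone.
Variables (R : realType) (k n : nat) (V : 'I_k -> seq 'rV[rat]_n).
Hypothesis V_neq0 : forall i, V i != [::].
Let P i : set 'rV[R]_n := conv_hull [set map_mx ratr v | v in [set` V i]].

(** Generators of the Cayley cone; the first [k] coordinates record the dilation factors. *)
Definition minkowski_gens : seq 'rV[rat]_(k + n) :=
  [seq row_mx (delta_mx 0 i) v | i <- enum 'I_k, v <- V i].

Lemma mem_minkowski_gens i v :
  v \in V i -> row_mx (delta_mx 0 i) v \in minkowski_gens.
Proof.
move=> vi; apply/allpairsPdep.
by exists i, v; rewrite mem_enum.
Qed.

Let in_sums (z : 'rV[R]_(k + n)) : Prop :=
  (forall i, 0 <= lsubmx z 0 i) /\
  exists2 p : 'I_k -> 'rV[R]_n, forall i, P i (p i) &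
    rsubmx z = \sum_i lsubmx z 0 i *: p i.

(** Adding [y (e_i, v)] raises [r_i] to [r_i + y] and replaces [p_i] by the average of [p_i] and [v]
    with weights proportional to [r_i] and [y]. *)
Lemma in_cone_minkowski z : in_cone minkowski_gens z -> in_sums z.
Proof.
move: z; apply: in_cone_ind.
  split; first by move=> i; rewrite !mxE.
  (* At the apex all factors are zero, so any points of the [P i] serve; [V i] is nonempty, so the
     default of [head] is not reached. *)
  exists (fun i => map_mx ratr (head 0 (V i))).
    move=> i; apply/sub_conv_hull; exists (head 0 (V i)) => //=.
    by case: (V i) (V_neq0 i) => //= v s _; rewrite mem_head.
  rewrite big1; first by apply/rowP => i; rewrite !mxE.
  by move=> i _; rewrite !mxE scale0r.
move=> _ z y /allpairsPdep[i [v [_ vi ->]]] y0 [z0 [p Pp zE]].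
rewrite /in_sums linearD linearZ /= map_row_mx row_mxKl.
rewrite linearD linearZ /= row_mxKr.
have zi0 := z0 i.
set r := lsubmx z in z0 zE zi0 *.
pose r' := r + y *: map_mx ratr (delta_mx 0 i).
have r'E j : r' 0 j = r 0 j + (if j == i then y else 0).
  rewrite !mxE eqxx /=; case: (j == i); first by rewrite rmorph1 mulr1.
  by rewrite rmorph0 mulr0.
rewrite -/r'; split.
  by move=> j; rewrite r'E addr_ge0//; case: ifP.
have [yi0|yi0] := eqVneq (r 0 i + y) 0.
  have {}y0 : y = 0 by lra.
  exists p => //; rewrite zE y0 scale0r addr0.
  by apply: eq_bigr => j _; rewrite r'E y0 if_same addr0.
pose t := y / (r 0 i + y).
exists (fun j => if j == i then (1 - t) *: p i + t *: map_mx ratr v else p j).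
  move=> j; case: eqP => [->|_] //; apply: conv_hull_segment.
  - exact: Pp.
  - by exists v.
  - rewrite divr_ge0 ?addr_ge0//= ler_pdivrMr ?mul1r ?lerDr//.
    by rewrite lt_def yi0 addr_ge0.
rewrite zE (bigD1 i)//= [RHS](bigD1 i)//= r'E eqxx addrAC; congr (_ + _).
  rewrite scalerDr !scalerA; congr (_ *: _ + _ *: _).
    by rewrite mulrBr mulr1 mulrC divfK// addrK.
  by rewrite mulrC divfK.
by apply: eq_bigr => j /negPf neqji; rewrite r'E neqji addr0.
Qed.

(** One direction is [in_cone_minkowski]. For the other, each inequality of the cone holds at the
    generators, so by linearity at [(e_i, p_i)] with [p_i] a convex combination of points of [V i],
    and then at [sum_i r_i (e_i, p_i)]. *)
Lemma minkowski_sum_in_cone (r : 'rV[rat]_k) x : orthant rat k r ->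
  minkowski_sum (fun i => dilate (r 0 i) (P i)) x <->
  in_cone minkowski_gens (row_mx (map_mx ratr r) x).
Proof.
move=> r0; split; last first.
  move=> /in_cone_minkowski[_ [p Pp]]; rewrite row_mxKl row_mxKr => ->.
  exists (fun i => ratr (r 0 i) *: p i); split.
    by move=> i; exists (p i).
  by apply: eq_bigr => i _; rewrite mxE.
move=> [q [Pq ->]].
have [p Pp] : {p & forall i, P i (p i) /\ ratr (r 0 i) *: p i = q i}.
  apply: (choice (P := fun i y => P i y /\ ratr (r 0 i) *: y = q i)) => i.
  by have [y] := Pq i; exists y.
have [s sG] := cone_halfspaces R minkowski_gens.
apply/sG => c cs.
have gen_le0 i v : v \in V i ->
    rat_form c (map_mx ratr (row_mx (delta_mx 0 i) v)) <= 0 :> R.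
  move=> vi; move: c cs; apply/sG; rewrite -[map_mx _ _]scale1r -[_ *: _]add0r.
  by apply: in_coneD; [exact: mem_minkowski_gens|exact: ler01|exact: in_cone0].
have -> : row_mx (map_mx ratr r) (\sum_i q i) =
    \sum_i ratr (r 0 i) *: row_mx (map_mx ratr (delta_mx 0 i)) (p i).
  rewrite -[RHS]hsubmxK !linear_sum /=; congr row_mx; last first.
    by apply: eq_bigr => i _; rewrite linearZ /= row_mxKr; case: (Pp i).
  rewrite [LHS]row_sum_delta; apply: eq_bigr => i _.
  by rewrite linearZ /= row_mxKl map_delta_mx mxE.
rewrite rat_form_sum; apply: sumr_le0 => i _; rewrite rat_formZ.
rewrite mulr_ge0_le0// ?ler0q//.
have [[m [v [w [Vv w0 w1 ->]]]] _] := Pp i.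
have -> : row_mx (map_mx ratr (delta_mx 0 i)) (\sum_j w j *: v j) =
    \sum_j w j *: row_mx (map_mx ratr (delta_mx 0 i)) (v j).
  rewrite -[RHS]hsubmxK !linear_sum /=; congr row_mx; last first.
    by apply: eq_bigr => j _; rewrite linearZ /= row_mxKr.
  under eq_bigr do rewrite linearZ /= row_mxKl.
  by rewrite -scaler_suml w1 scale1r.
rewrite rat_form_sum; apply: sumr_le0 => j _; rewrite rat_formZ.
rewrite mulr_ge0_le0//; have [u uV <-] := Vv j.
by rewrite -map_row_mx gen_le0.
Qed.

End MinkowskiCone.

Lemma common_denominator (l : seq rat) :
  exists2 D : rat, 0 < D & forall q, q \in l -> D * q \is a Num.int.
Proof.
(* [D] itself is kept integral, so that [D * denq q * q = D * numq q] is integral for the next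
   [q]. *)
suff [D [D0 Dint Dl]] : exists D : rat, [/\ 0 < D, D \is a Num.int
    & forall q, q \in l -> D * q \is a Num.int] by exists D.
elim: l => [|q l [D [D0 Dint Dl]]]; first by exists 1; rewrite ltr01 rpred1.
exists (D * (denq q)%:~R); split.
- by rewrite mulr_gt0// ltr0z denq_gt0.
- by rewrite rpredM// intr_int.
- move=> u; rewrite inE => /predU1P[->|ul].
    rewrite -mulrA rpredM//.
    by rewrite -{2}(divq_num_den q) mulrC divfK ?intr_eq0 ?denq_neq0// intr_int.
  by rewrite mulrAC rpredM ?Dl// intr_int.
Qed.

Lemma ratr_is_int (R : archiNumFieldType) (q : rat) :
  q \is a Num.int -> (ratr q : R) \is a Num.int.
Proof. by move=> /intrP[z ->]; rewrite ratr_int intr_int. Qed.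

Section CountCeil.
Variables (R : realType) (k n : nat) (P : 'I_k -> set 'rV[R]_n).
Hypothesis P_rational : forall i, rational_polytope (P i).
Variable d : 'I_k -> rat.
Hypothesis d_gt0 : forall i, 0 < d i.

(* For integral [x], the inequality [c1 . r + c2 . x <= 0] with [c2] integral
   only depends on the ceiling of [c1 . r], and shifting [r] by [U (.) d]
   adds an integer to [c1 . r] once [c1] is scaled suitably. *)
Lemma lattice_count_ceil : exists m (M : 'M[rat]_(k, m)),
  forall r s : 'rV[rat]_k, orthant rat k r -> orthant rat k s ->
    (forall j, Num.ceil ((map_mx ratr r *m map_mx ratr M : 'rV[R]_m) 0 j) =
               Num.ceil ((map_mx ratr s *m map_mx ratr M : 'rV[R]_m) 0 j)) ->
  forall U, lattice_count P (r + lattice_shift d U) =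
            lattice_count P (s + lattice_shift d U).
Proof.
have [V VP] : {V : 'I_k -> seq 'rV[rat]_n & forall i, V i != [::] /\
    P i = conv_hull [set map_mx ratr v | v in [set` V i]]}.
  exact: (choice P_rational).
have V0 i : V i != [::] by case: (VP i).
have PE : P = fun i => conv_hull [set map_mx ratr v | v in [set` V i]].
  by apply/funext => i; case: (VP i).
have [sc scP] := cone_halfspaces R (minkowski_gens V).
(* The denominators to clear are those of the entries of [c2] and of the products [c1_i d_i]. *)
pose l := [seq (c : 'cV[rat]_(k + n)) (rshift k i) 0 |
             c <- sc, i <- enum 'I_n] ++
          [seq (c : 'cV[rat]_(k + n)) (lshift n i) 0 * d i |
             c <- sc, i <- enum 'I_k].
have [D D0 Dl] := common_denominator l.
pose M : 'M[rat]_(k, size sc) := \matrix_(i, j) (D * sc`_j (lshift n i) 0).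
exists (size sc), M => r s r0 s0 eqrs U.
have ME (a : 'rV[R]_k) j :
    (a *m map_mx ratr M) 0 j = ratr D * rat_form (usubmx sc`_j) a.
  rewrite /rat_form !mxE mulr_sumr; apply: eq_bigr => i _.
  by rewrite !mxE rmorphM mulrCA.
(* Multiplied by [D], the [j]th inequality at [(t + U (.) d, x)] reads [(t M)_j <= z j x], with an
   integer on the right for integral [x]. *)
pose z (j : 'I_(size sc)) (x : 'rV[R]_n) : R :=
  - (ratr D * rat_form (dsubmx sc`_j) x +
     (map_mx ratr (lattice_shift d U) *m map_mx ratr M : 'rV[R]_(size sc)) 0 j).
have z_int j x : x \is a mxOver Num.int -> z j x \is a Num.int.
  move=> /mxOverP x_int; rewrite rpredN /rat_form !mxE mulr_sumr.
  rewrite rpredD// rpred_sum//.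
    move=> i _; rewrite !mxE mulrCA rpredM ?x_int// -rmorphM/= ratr_is_int//.
    apply: Dl; rewrite mem_cat; apply/orP; left; apply/allpairsP.
    by exists (sc`_j, i); rewrite mem_enum mem_nth.
  move=> i _; rewrite !mxE -rmorphM/= ratr_is_int// -mulrA rpredM ?natr_int//.
  rewrite mulrCA [d i * _]mulrC; apply: Dl; rewrite mem_cat; apply/orP; right.
  by apply/allpairsP; exists (sc`_j, i); rewrite mem_enum mem_nth.
have key (t : 'rV[rat]_k) (x : 'rV[R]_n) : orthant rat k t ->
    minkowski_sum (fun i => dilate ((t + lattice_shift d U) 0 i) (P i)) x <->
    forall j, (map_mx ratr t *m map_mx ratr M) 0 j <= z j x.
  move=> t0; rewrite PE.
  have tU0 := orthantD t0 (orthant_lattice_shift d_gt0 U).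
  apply: (iff_trans (minkowski_sum_in_cone V0 x tU0)).
  have formE (j : 'I_(size sc)) :
      (rat_form sc`_j (row_mx (map_mx ratr (t + lattice_shift d U)) x) <= 0) =
      ((map_mx ratr t *m map_mx ratr M) 0 j <= z j x).
    rewrite -[in LHS](vsubmxK sc`_j) /rat_form map_col_mx mul_row_col mxE.
    rewrite -/(rat_form _ _) -/(rat_form _ _) map_mxD rat_formD /z !ME.
    rewrite -oppr_ge0 -[LHS](pmulr_rge0 (x := ratr D)) ?ltr0q// -[RHS]subr_ge0.
    by congr (0 <= _); ring.
  apply: (iff_trans (scP _)); split=> [H j|H c /(nthP 0)[j ltj <-]].
    by rewrite -formE; apply: H; rewrite mem_nth.
  by rewrite -[j]/(nat_of_ord (Ordinal ltj)) formE.
(* The floor merely casts the integer [z j x] to [int]; a number is at most an integer iff its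
   ceiling is. *)
have le_z (t : 'rV[rat]_k) x j : x \is a mxOver Num.int ->
    ((map_mx ratr t *m map_mx ratr M : 'rV[R]_(size sc)) 0 j <= z j x) =
    (Num.ceil ((map_mx ratr t *m map_mx ratr M : 'rV[R]_(size sc)) 0 j) <=
      Num.floor (z j x)).
  by move=> /(z_int j) zj; rewrite ceil_le_int floorK.
rewrite /lattice_count (_ : _ `&` _ =
  minkowski_sum (fun i => dilate ((s + lattice_shift d U) 0 i) (P i))
    `&` int_points) //.
apply/seteqP; split=> x [Px x_int]; split=> //.
  apply/key => // j; rewrite le_z// -eqrs -le_z//.
  by move: j; apply/key.
apply/key => // j; rewrite le_z// eqrs -le_z//.
by move: j; apply/key.
Qed.

End CountCeil.

(** * Cells *)

Section Cells.
Variables (R : realType) (k m : nat) (M : 'M[R]_(k, m)).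
Implicit Types x y z : 'rV[R]_k.

Lemma nbhs_mulmx x (e : R) j : 0 < e ->
  \forall y \near x, `|(y *m M) 0 j - (x *m M) 0 j| < e.
Proof.
move=> e0; set C := 1 + \sum_i `|M i j|.
have C0 : 0 < C by rewrite ltr_pwDl// sumr_ge0.
apply/nbhs_ballP; exists (e / C); first by rewrite /= divr_gt0.
move=> y [_ xy].
have -> : (y *m M) 0 j - (x *m M) 0 j = \sum_i (y 0 i - x 0 i) * M i j.
  by rewrite !mxE -sumrB; apply: eq_bigr => i _; rewrite mulrBl.
apply: (le_lt_trans (ler_norm_sum _ _ _)).
apply: (@le_lt_trans _ _ (\sum_i (e / C * `|M i j|))).
  apply: ler_sum => i _; rewrite normrM ler_wpM2r// distrC ltW//.
  exact: xy.
rewrite -mulr_sumr mulrAC ltr_pdivrMr// ltr_pM2l//.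
by rewrite /C ltrDr.
Qed.

(** The faces of the arrangement of hyperplanes [(y M)_j = z], [z] an integer: each [(y M)_j] is a
    fixed integer or ranges in a fixed open unit interval. *)
Definition cell x : set 'rV[R]_k :=
  [set y | forall j, Num.floor ((y *m M) 0 j) = Num.floor ((x *m M) 0 j) /\
                     Num.ceil ((y *m M) 0 j) = Num.ceil ((x *m M) 0 j)].

Definition closed_cell x : set 'rV[R]_k :=
  [set y | forall j, (Num.floor ((x *m M) 0 j))%:~R <= (y *m M) 0 j
                       <= (Num.ceil ((x *m M) 0 j))%:~R].

Lemma cell_refl x : cell x x. Proof. by []. Qed.

Lemma cell_eq x y : cell x y -> cell x = cell y.
Proof.
by move=> xy; apply/seteqP; split=> z xz j; have [-> ->] := xz j;
  have [-> ->] := xy j.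
Qed.

Lemma cell_sub x : cell x `<=` closed_cell x.
Proof. by move=> y xy j; have [<- <-] := xy j; rewrite floor_le ceil_ge. Qed.

Lemma closed_cell_polyhedron x : polyhedron (closed_cell x).
Proof.
exists (m + m)%N, (row_mx M (- M)),
  (row_mx (\row_j (Num.ceil ((x *m M) 0 j))%:~R)
          (\row_j (- (Num.floor ((x *m M) 0 j))%:~R))).
apply/seteqP; split=> y /= H j; rewrite ?mul_mx_row.
  case: (split_ordP j) => i ->; have /andP[] := H i.
    by move=> _; rewrite !row_mxEl mxE.
  by move=> + _; rewrite !row_mxEr mulmxN !mxE lerN2.
have := H (rshift m j); have := H (lshift m j).
rewrite mul_mx_row !row_mxEl !row_mxEr mulmxN.
by move: (y *m M) (x *m M) => A B; rewrite !mxE lerN2 => -> ->.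
Qed.

(* On the affine hull of the closed cell the coordinates of [y *m M] that are
   integral at [x] are constant; the others have room to move inside the cell,
   and a boundary point leaves the closed cell when pushed away from [x]. *)
Lemma relint_closed_cell x : relint (closed_cell x) = cell x.
Proof.
have xx : closed_cell x x by apply/cell_sub/cell_refl.
apply/seteqP; split=> y.
  move=> [xy /nbhs_ballP[e /= e0 ye]].
  (* [C] is chosen so that prolonging the segment from [x] to [y] by [t (y - x)] stays within [e] of
     [y]. *)
  pose C : R := 1 + \sum_i `|y 0 i - x 0 i|.
  have C0 : 0 < C by rewrite ltr_pwDl// sumr_ge0.
  pose t := e / C; have t0 : 0 < t by rewrite divr_gt0.
  have zin : closed_cell x (y + t *: (y - x)).
    apply: ye.
      split=> // i j; rewrite (ord1 i) /ball /= !mxE opprD addNKr normrN normrM.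
      rewrite gtr0_norm// /t mulrAC ltr_pdivrMr// ltr_pM2l//.
      by rewrite /C (bigD1 j)//= ltr_pwDl// lerDl sumr_ge0.
    exists 2%N, (fun i => if i == 0 then y else x),
      (fun i => if i == 0 then 1 + t else - t); split.
    - by move=> i; case: ifP.
    - by rewrite !big_ord_recl big_ord0 /= addr0 addrK.
    - rewrite !big_ord_recl big_ord0 /= addr0.
      by rewrite scalerBr scalerDl scale1r scaleNr addrA.
  move=> j; have /andP[fy yc] := xy j; have /andP[fx xc] := xx j.
  have /andP[fz zc] := zin j.
  have zE : ((y + t *: (y - x)) *m M) 0 j =
      (y *m M) 0 j + t * ((y *m M) 0 j - (x *m M) 0 j).
    by rewrite mulmxDl -scalemxAl mulmxBl !mxE.
  rewrite zE in fz zc.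
  have := ceil_floor ((x *m M) 0 j).
  have [xint|xnint] := boolP ((x *m M) 0 j \is a Num.int).
    rewrite addr0 => cf; rewrite cf in yc *.
    have -> : (y *m M) 0 j = (Num.floor ((x *m M) 0 j))%:~R.
      by apply/le_anti/andP.
    by rewrite intrKfloor intrKceil.
  move=> /= cf; have fx' : (Num.floor ((x *m M) 0 j))%:~R < (x *m M) 0 j.
    by rewrite lt_neqAle fx andbT -intrEfloor.
  have xc' : (x *m M) 0 j < (Num.ceil ((x *m M) 0 j))%:~R.
    by rewrite lt_neqAle xc andbT eq_sym -intrEceil.
  (* If [y] attained a bound, the prolonged point would violate it, as [x] satisfies it strictly. *)
  have fy' : (Num.floor ((x *m M) 0 j))%:~R < (y *m M) 0 j by nra.
  have yc' : (y *m M) 0 j < (Num.ceil ((x *m M) 0 j))%:~R by nra.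
  split.
    apply: floor_def; rewrite fy/=; move: yc'; rewrite cf.
    by [].
  by apply: ceil_def; rewrite yc andbT cf addrK.
move=> xy; split; first exact: cell_sub.
have Pr j : \forall z \near y, aff_hull (closed_cell x) z ->
    (Num.floor ((x *m M) 0 j))%:~R <= (z *m M) 0 j
                       <= (Num.ceil ((x *m M) 0 j))%:~R.
  have [<- <-] := xy j; set u := (y *m M) 0 j.
  have := ceil_floor u.
  have [uint|unint] := boolP (u \is a Num.int).
    rewrite addr0 => cf; apply: (nearW (F := nbhs y)) => z.
    move=> [p [v [w [xv w1 ->]]]].
    have vj i : (v i *m M) 0 j = (Num.floor u)%:~R.
      have := xv i j; have [<- <-] := xy j; rewrite -/u cf.
      by move=> /le_anti.
    rewrite cf -eq_le mulmx_suml summxE.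
    under eq_bigr do rewrite -scalemxAl mxE vj.
    by rewrite -mulr_suml w1 mul1r.
  move=> _; have fu : (Num.floor u)%:~R < u.
    by rewrite lt_neqAle floor_le andbT -intrEfloor.
  have uc : u < (Num.ceil u)%:~R.
    by rewrite lt_neqAle ceil_ge andbT eq_sym -intrEceil.
  near=> z => _; have z1 : `|(z *m M) 0 j - u| < u - (Num.floor u)%:~R.
    by near: z; apply: nbhs_mulmx; rewrite subr_gt0.
  have z2 : `|(z *m M) 0 j - u| < (Num.ceil u)%:~R - u.
    by near: z; apply: nbhs_mulmx; rewrite subr_gt0.
  move: z1 z2; rewrite !ltr_norml => /andP[? ?] /andP[? ?].
  by apply/andP; split; lra.
apply: (filterS (F := nbhs y)) (filter_forall (F := nbhs y) _ Pr) => z H hz j.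
exact: H.
Unshelve. all: by end_near. Qed.

Lemma cell_relopen x : relopen_polyhedron (cell x).
Proof.
exists (closed_cell x); split; first exact: closed_cell_polyhedron.
by rewrite relint_closed_cell.
Qed.

(** Where every [(y M)_j] is within [1] of its value at [x], floors and ceilings change by at most
    [1], which leaves finitely many cells. *)
Lemma cells_locally_finite : locally_finite (range cell).
Proof.
move=> x; exists [set y | forall j, `|(y *m M) 0 j - (x *m M) 0 j| < 1].
  by apply: (filter_forall (F := nbhs x)) => j; exact: nbhs_mulmx.
(* The changes [-1, 0, 1] are encoded in ['I_3] by adding [1]. *)
pose g (t : {ffun 'I_m -> 'I_3 * 'I_3}) := [set y : 'rV[R]_k | forall j,
  Num.floor ((y *m M) 0 j) = Num.floor ((x *m M) 0 j) - 1 + (t j).1%:Z /\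
  Num.ceil ((y *m M) 0 j) = Num.ceil ((x *m M) 0 j) - 1 + (t j).2%:Z].
apply: (@sub_finite_set _ _ (range g)); last exact/finite_image/finite_finset.
move=> _ [[z _ <-] [y [/cell_eq-> xy]]].
have near_int j : exists t : 'I_3 * 'I_3,
    Num.floor ((y *m M) 0 j) = Num.floor ((x *m M) 0 j) - 1 + t.1%:Z /\
    Num.ceil ((y *m M) 0 j) = Num.ceil ((x *m M) 0 j) - 1 + t.2%:Z.
  have := xy j; rewrite ltr_norml; move: (_ 0 j) (_ 0 j) => b a /andP[ab1 ab2].
  pose f := Num.floor a - Num.floor b + 1.
  pose c := Num.ceil a - Num.ceil b + 1.
  have f03 : 0 <= f < 3.
    have /andP[fb1 fb2] := floor_itv b; have /andP[fa1 fa2] := floor_itv a.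
    have : ((-1)%:~R : R) < f%:~R /\ (f%:~R : R) < 3%:~R.
      by move: fb2 fa2; rewrite /f !rmorphD/= !rmorphN/= => ? ?; split; lra.
    by rewrite !ltr_int; lia.
  have c03 : 0 <= c < 3.
    have /andP[cb1 cb2] := ceil_itv b; have /andP[ca1 ca2] := ceil_itv a.
    have : ((-1)%:~R : R) < c%:~R /\ (c%:~R : R) < 3%:~R.
      by move: cb1 ca1; rewrite /c !rmorphD/= !rmorphN/= => ? ?; split; lra.
    by rewrite !ltr_int; lia.
  have fE : Num.floor a = Num.floor b - 1 + f by rewrite /f; lia.
  have cE : Num.ceil a = Num.ceil b - 1 + c by rewrite /c; lia.
  move: f c f03 c03 fE cE => f c /andP[f0 f3] /andP[c0 c3] fE cE.
  exists (inord `|f|%N, inord `|c|%N); rewrite /= !inordK; [|lia|lia].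
  by rewrite !gez0_abs.
have [t tE] := choice near_int.
exists [ffun j => t j] => //; apply/seteqP; split=> u zy j.
  by have [-> ->] := zy j; rewrite ffunE; have [-> ->] := tE j.
by have [-> ->] := zy j; rewrite ffunE; have [-> ->] := tE j.
Qed.

End Cells.

(** * Partial derivatives *)

Lemma rden_gt0 (R : realType) n (P : set 'rV[R]_n) : 0 < rden P.
Proof. by rewrite /rden; case: ifP => // _; case: xgetP => // d _ []. Qed.

Lemma multi_index k N (I : 'I_k -> nat) : (mnorm I <= N)%N ->
  {I' : {ffun 'I_k -> 'I_N.+1} | I = fun j => I' j}.
Proof.
move=> leIN; exists [ffun j => inord (I j)]; apply/funext => j.
rewrite ffunE inordK// ltnS (leq_trans _ leIN)//.
by rewrite /mnorm (bigD1 j)//= leq_addr.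
Qed.

(** Continuity with tolerance [1] suffices: naturals at distance less than [1] are equal. *)
Lemma continuous_nat_locally_constant k (f : 'rV[rat]_k -> nat) x :
    continuous_on_orthant_at (fun s => (f s)%:R) x ->
  exists2 e : rat, 0 < e & forall y, orthant rat k y ->
    (forall i, `|x 0 i - y 0 i| < e) -> f y = f x.
Proof.
move=> /cvgrPdist_lt /(_ 1 ltr01) /nbhs_ballP[e /= e0 xe].
exists e => // y y0 xy.
have : `|(f x)%:R - (f y)%:R| < 1 :> rat.
  by apply: xe => //; split=> // i j; rewrite (ord1 i) /ball /=; exact: xy.
by rewrite !pmulrn -rmorphB/= -intr_norm ltrz1; lia.
Qed.

(** Factor [g - g(0) = q X]: the quotient is [q(h)] for [h != 0], and [q(0) = g'(0)]. *)
Lemma difference_quotient_poly (g : {poly rat}) (D : set rat) :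
  ((fun h : rat^o => (g.[h] - g.[0]) / h) : rat^o -> rat^o)
    @ within D ((0 : rat^o)^') --> (g^`().[0] : rat^o).
Proof.
have /factor_theorem[q gq] : root (g - g.[0]%:P) 0.
  by rewrite /root hornerD hornerN hornerC subrr.
have -> : g^`().[0] = q.[0].
  have -> : g = q * ('X - 0%:P) + g.[0]%:P by rewrite -gq subrK.
  by rewrite derivD derivM derivC derivXsubC !hornerE; ring.
have qc : (fun h : rat^o => q.[h] : rat^o)
    @ within D (0 : rat^o)^' --> (q.[0] : rat^o).
  apply: cvg_trans (@continuous_horner _ q (0 : rat^o)).
  apply: cvg_app => A /= A0; apply: cvg_within; exact: cvg_within.
apply: cvg_trans qc; apply: near_eq_cvg.
apply: cvg_within; near=> h; have h0 : h != 0 by near: h; exact: nbhs_dnbhs_neq.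
have /(congr1 (fun p => p.[h])) := gq.
by rewrite !hornerE => ->; rewrite mulfK.
Unshelve. all: by end_near. Qed.

Section ShiftDerivative.
Variables (k N : nat) (f : {ffun 'I_k -> 'I_N.+1} -> rat).
Variables (j : 'I_k) (r : 'rV[rat]_k).
Implicit Types I J : {ffun 'I_k -> 'I_N.+1}.

(** The coefficient of [y^I] in [f(y - r - h e_j)] as a polynomial in [h], which enters only through
    the [j]th factor. *)
Definition shift_line I : {poly rat} :=
  \sum_(J : {ffun 'I_k -> 'I_N.+1})
    (f J * \prod_(i < k | i != j) ('C(J i, I i)%:R * (- r 0 i) ^+ (J i - I i)) *
       'C(J j, I j)%:R) *: (- (r 0 j)%:P - 'X) ^+ (J j - I j).

Lemma shift_lineE I h :
  (shift_line I).[h] = poly_shift (fun i => - (r + h *: delta_mx 0 j) 0 i) f I.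
Proof.
rewrite /shift_line horner_sum; apply: eq_bigr => J _.
rewrite !hornerE /= [in RHS](bigD1 j)//=.
rewrite -[in RHS](@eq_bigr _ _ _ _ _ _
  (fun i => 'C(J i, I i)%:R * (- r 0 i) ^+ (J i - I i))).
  by rewrite !mxE !eqxx mulr1 opprD; ring.
by move=> i /negPf neqij; rewrite !mxE neqij mulr0 addr0.
Qed.

(** Differentiating the power yields the factor [-(J_j - I_j)], and [(J_j - I_j) C(J_j, I_j) = (I_j
    + 1) C(J_j, I_j + 1)]. *)
Lemma deriv_shift_line I I' : 
    (forall i, I' i = mincr (fun l => I l) j i :> nat) ->
  (shift_line I)^`().[0] =
  - (I j).+1%:R * poly_shift (fun i => - r 0 i) f I'.
Proof.
move=> I'E; rewrite /shift_line raddf_sum horner_sum mulr_sumr.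
apply: eq_bigr => J _; rewrite /= derivZ deriv_exp.
rewrite [in RHS](bigD1 j)//= !hornerE /=.
have -> : \prod_(i < k | i != j)
      ('C(J i, I' i)%:R * (- r 0 i) ^+ (J i - I' i)) =
    \prod_(i < k | i != j) ('C(J i, I i)%:R * (- r 0 i) ^+ (J i - I i)).
  by apply: eq_bigr => i /negPf neqij; rewrite !I'E /mincr neqij addn0.
rewrite !I'E /mincr eqxx addn1.
have := congr1 (fun n => n%:R : rat) (mul_bin_left (J j) (I j)).
rewrite subnS !natrM => mulC.
set X := \prod_(_ < k | _) _; set e := (J j - I j)%N in mulC *.
have -> : ((- (r 0 j)%:P - 'X)^`() * (- (r 0 j)%:P - 'X) ^+ e.-1 *+ e).[0] =
    - ((- r 0 j) ^+ e.-1 * e%:R).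
  rewrite derivB derivN derivC derivX hornerMn !hornerE -mulr_natr.
  by ring.
transitivity (- (f J * X * (- r 0 j) ^+ e.-1) * (e%:R * 'C(J j, I j)%:R)).
  by ring.
by rewrite -mulC; ring.
Qed.

End ShiftDerivative.

(** * Piecewise polynomiality and the derivative formula *)

Theorem theorem1p6 (R : realType) (k n : nat) (P : 'I_k -> set 'rV[R]_n)
    (P_rational : forall i, rational_polytope (P i))
    (P_dim : has_dim (minkowski_sum P) n)
    (QI : ('I_k -> nat) -> 'rV[rat]_k -> rat)
    (QI_coefs : quasi_polynomial_coefs n (fun i => rden (P i))
                  (fun r => (lattice_count P r)%:R) QI) :
  (forall I : 'I_k -> nat, (mnorm I <= n)%N ->
     piecewise_polynomial R (n - mnorm I) (fun j => (n - I j)%N) (QI I)) /\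
  (forall (j : 'I_k) (I : 'I_k -> nat) (r : 'rV[rat]_k),
     (mnorm I < n)%N -> orthant rat k r ->
     (forall U : 'I_k -> nat,
        continuous_on_orthant_at (fun s => (lattice_count P s)%:R)
          (r + \row_i ((U i)%:R * rden (P i)))) ->
     has_partial (QI I) j r (- (I j).+1%:R * QI (mincr I j) r)).
Proof.
have d_gt0 i : 0 < rden (P i) by exact: rden_gt0.
split.
  move=> I leIn; have [I' IE] := multi_index leIn; rewrite IE in leIn *.
  have [m [M0 M0P]] := lattice_count_ceil P_rational d_gt0.
  (* The identity block makes cells fix the floors of the coordinates, so that a cell of a point of
     the orthant lies in the orthant. *)
  pose M : 'M[R]_(k, k + m) := row_mx 1%:M (map_mx ratr M0).
  have cell_orthant x y : orthant R k x -> cell M x y -> orthant R k y.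
    move=> x0 xy i; have [fxy _] := xy (lshift m i).
    move: fxy; rewrite !mul_mx_row !row_mxEl !mulmx1 => fxy.
    by rewrite -floor_ge0 fxy floor_ge0.
  exists (cell M @` orthant R k); split.
  - split.
    + apply/seteqP; split=> [x [_ [y y0 <-]]|x x0]; first exact: cell_orthant.
      by exists (cell M x) => //; exists x.
    + move=> _ _ [x _ <-] [y _ <-] [z [/cell_eq-> /cell_eq->]] //.
    + by move=> _ [x _ <-]; exists x.
  - move=> x; have [U xU finU] := cells_locally_finite M x.
    exists U => //; apply: sub_finite_set finU => S [[y _ <-] SU].
    by split => //; exists y.
  - by move=> _ [x _ <-]; exact: cell_relopen.
  move=> _ [x x0 <-].
  (* A cell without rational points imposes no condition; the zero polynomial serves. *)
  have [[r xr]|no_rational] := pselect (exists r, cell M x (map_mx ratr r));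
    last first.
    apply: (ShiftMPoly.polynomial_on_shift (f := fun=> 0)) => // r xr.
    by case: no_rational; exists r.
  have rat_orthant s : cell M x (map_mx ratr s) -> orthant rat k s.
    by move=> /(cell_orthant _ _ x0) s0 i; have := s0 i; rewrite mxE ler0q.
  (* The polynomial centered at one rational point [r] serves for all rational points of the
     cell. *)
  apply: (ShiftMPoly.polynomial_on_shift (f := centered_coefs QI r)).
    by move=> J ltnJ; exact: centered_coefs_degree.
  move=> s xs; apply: (coef_eq QI_coefs d_gt0) => //; try exact: rat_orthant.
  move=> U; congr (_%:R); apply: M0P; try exact: rat_orthant.
  move=> i; have [_] := xr (rshift k i); have [_] := xs (rshift k i).
  by rewrite !mul_mx_row !row_mxEr => -> ->.
move=> j I r ltIn r0 r_cont.
have leIn := ltnW ltIn.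
have leIjn : (mnorm (mincr I j) <= n)%N.
  rewrite /mnorm /mincr big_split /= (bigD1 j)//=.
  rewrite [X in (_ + X)%N](bigD1 j)//= eqxx.
  rewrite [X in (_ + (1 + X))%N]big1 ?addn0 ?addn1; last by move=> i /negPf->.
  by move: ltIn; rewrite /mnorm (bigD1 j).
have [I' IE] := multi_index leIn; have [I'' IjE] := multi_index leIjn.
rewrite IjE; rewrite IE in leIn *.
pose f : {ffun 'I_k -> 'I_n.+1} -> rat := centered_coefs QI r.
pose sh (U : {ffun 'I_k -> 'I_n.+1}) :=
  lattice_shift (fun i => rden (P i)) (fun i => U i).
(* To be used both at [s = r] and at [s = r + h e_j]. *)
have QE s (I1 : {ffun 'I_k -> 'I_n.+1}) :
    (mnorm (fun i => I1 i) <= n)%N -> orthant rat k s ->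
    (forall U, lattice_count P (r + sh U) = lattice_count P (s + sh U)) ->
    QI (fun i => I1 i) s = poly_shift (fun i => - s 0 i) f I1.
  move=> leI1 s0 eqrs; apply: (coef_eq QI_coefs d_gt0) => // U.
  by rewrite [in LHS]eqrs.
rewrite [QI (fun i => I'' i) r]QE//; last by rewrite -IjE.
rewrite -(@deriv_shift_line k n f j r I' I''); last first.
  by move=> i; rewrite -IE -[RHS]/((mincr I j) i) IjE.
have g0 : QI (fun i => I' i) r = (shift_line f j r I').[0].
  by rewrite shift_lineE scale0r addr0 QE.
apply: cvg_trans (@difference_quotient_poly (shift_line f j r I')
  [set h | orthant rat k (r + h *: delta_mx 0 j)]).
apply: near_eq_cvg.
(* Each of the finitely many [U] in the box gives a punctured neighbourhood of [0] where its count
   is constant; on their intersection [QI] follows [shift_line]. *)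
have rU U : \forall h \near (0 : rat^o)^',
    orthant rat k (r + h *: delta_mx 0 j) ->
    lattice_count P (r + sh U) =
    lattice_count P (r + h *: delta_mx 0 j + sh U).
  have [e e0 eP] := continuous_nat_locally_constant (r_cont (fun i => U i)).
  apply: nbhs_dnbhs; apply/nbhs_ballP; exists e => // h /= h_small h0.
  apply/esym/eP.
    apply: orthantD => //; exact: orthant_lattice_shift.
  move=> i; rewrite /ball /= sub0r normrN in h_small.
  apply: le_lt_trans h_small; rewrite !mxE eqxx /=.
  have -> : r 0 i + (U i)%:R * rden (P i) -
    (r 0 i + h * (i == j)%:R + (U i)%:R * rden (P i)) = - (h * (i == j)%:R).
    by ring.
  rewrite normrN normrM.
  by case: (i == j); rewrite ?normr1 ?normr0 ?mulr1 ?mulr0.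
apply: (filterS (F := (0 : rat^o)^'))
  (filter_forall (F := (0 : rat^o)^') _ rU) => h rh h0 /=.
by rewrite g0 shift_lineE QE// => U; exact: rh.
Qed.
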